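(* Assume (C). Let $h>0$, $n\ge1$, $T=nh$ and $a>0$ deterministic. Then $$\Delta\big(\mathcal G_0^{T},\widetilde{\mathcal G}_0^{\bar A_T(Y)}\big)=0\quad\text{and}\quad\Delta\big(\mathcal G_0^{\bar\tau_a(X)},\widetilde{\mathcal G}_0^{a}\big)=0.$$
   Context: $\sigma\in C^2(\mathbb R)$ satisfies (C): $0<\sigma_0^2\le\sigma^2\le\sigma_1^2$, $|\sigma'|+|\sigma''|\le K_\sigma$; $\mathcal F_K=\{b\in C^1(\mathbb R):|b|+|b'|\le K\}$; $f=b/\sigma^2$; $t_i=ih$. The continuous Euler scheme $\bar\xi$ solves $d\bar\xi_t=\bar b_h(t,\bar\xi)dt+\bar\sigma_h(t,\bar\xi)dW_t$, $\bar\xi_0=\eta$ ($W$ Brownian motion, $\eta$ initial variable with law independent of $b$), where $\bar b_h(t,x)=\sum_{i\ge1}b(x(t_{i-1}))1_{(t_{i-1},t_i]}(t)$, $\bar\sigma_h(t,x)=\sum_{i\ge1}\sigma(x(t_{i-1}))1_{(t_{i-1},t_i]}(t)$. Path functionals: $\bar\rho_t(x)=\int_0^t\bar\sigma_h^2(s,x)ds$, $\bar\tau_u(x)=\inf\{t\ge0:\bar\rho_t(x)\ge u\}$; $\bar A_0(y)=0$, $\bar A_t(y)=\bar A_{t_{i-1}}(y)+\sigma^2(y(\bar A_{t_{i-1}}(y)))(t-t_{i-1})$ for $t\in(t_{i-1},t_i]$. Canonical space $C=C(\mathbb R^+,\mathbb R)$ with canonical process written $X$ (filtration $\mathcal C^X_t=\bigcap_{s>t}\sigma(X_r,r\le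 s)$) or $Y$ (filtration $\mathcal C^Y_u$ likewise). $Q_b$ is the law of $\bar\xi$; $\widetilde Q_b$ is the law of $\bar\zeta_u=\bar\xi_{\bar\tau_u(\bar\xi)}$. For stopping times $T,A$: $\mathcal G_0^T=(C,\mathcal C^X_T,(Q_b|_{\mathcal C^X_T})_{b\in\mathcal F_K})$, $\widetilde{\mathcal G}_0^A=(C,\mathcal C^Y_A,(\widetilde Q_b|_{\mathcal C^Y_A})_{b\in\mathcal F_K})$. Le Cam distance: $\delta(\mathcal E,\mathcal G)=\inf_M\sup_b\|MP_b-Q_b\|_{TV}$ over Markov kernels $M$ (not depending on $b$), $\Delta=\max\{\delta(\mathcal E,\mathcal G),\delta(\mathcal G,\mathcal E)\}$. *)

(* Defs.v *)
From HB Require Import structures.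
From mathcomp Require Import all_boot all_order all_algebra.
From mathcomp Require Import all_classical all_reals all_analysis.
Set Implicit Arguments. Unset Strict Implicit. Unset Printing Implicit Defensive.
Import Order.TTheory GRing.Theory Num.Theory.
Import numFieldNormedType.Exports.
Local Open Scope classical_set_scope.
Local Open Scope ring_scope.

Section Defs.
Context {R : realType}.

(* for t > 0, [cell h t] is the unique k with t_k < t <= t_{k+1}
   (i.e. k = i-1 where t in (t_{i-1}, t_i]) *)
Definition cell (h t : R) : nat := absz (Num.ceil (t / h) - 1).

(* bar sigma_h(t,x) = sum_{i>=1} sigma(x(t_{i-1})) 1_{(t_{i-1},t_i]}(t) *)
Definition sigmah (h : R) (sig : R -> R) (t : R) (x : R -> R) : R :=
  if 0 < t then sig (x ((cell h t)%:R * h)) else 0.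

Definition rhobar (h : R) (sig : R -> R) (t : R) (x : R -> R) : R :=
  Rintegral lebesgue_measure `[0, t] (fun s => sigmah h sig s x ^+ 2).

Definition taubar (h : R) (sig : R -> R) (u : R) (x : R -> R) : R :=
  inf [set t | 0 <= t /\ u <= rhobar h sig t x].

Fixpoint Agrid (h : R) (sig : R -> R) (y : R -> R) (k : nat) : R :=
  match k with
  | O => 0
  | S k' => Agrid h sig y k' + sig (y (Agrid h sig y k')) ^+ 2 * h
  end.

Definition Abar (h : R) (sig : R -> R) (t : R) (y : R -> R) : R :=
  if 0 < t then
    let k := cell h t in
    Agrid h sig y k + sig (y (Agrid h sig y k)) ^+ 2 * (t - k%:R * h)
  else 0.

Fixpoint xigrid (h : R) (b sig : R -> R) (e : R) (w : R -> R) (k : nat) : R :=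
  match k with
  | O => e
  | S k' => let z := xigrid h b sig e w k' in
            z + b z * h + sig z * (w (k'.+1%:R * h) - w (k'%:R * h))
  end.

(* solution of d xi = bar b_h(t,xi) dt + bar sigma_h(t,xi) dW, xi_0 = e,
   written piecewise (coefficients are constant on each (t_{i-1},t_i]);
   paths are extended to t < 0 by the constant xi_0. *)
Definition Xi (h : R) (b sig : R -> R) (e : R) (w : R -> R) (t : R) : R :=
  if 0 < t then
    let k := cell h t in
    let z := xigrid h b sig e w k in
    z + b z * (t - k%:R * h) + sig z * (w t - w (k%:R * h))
  else e.

Definition Zeta (h : R) (b sig : R -> R) (e : R) (w : R -> R) (u : R) : R :=
  Xi h b sig e w (taubar h sig u (Xi h b sig e w)).

(* a path of C(R^+,R) is represented by its extension to R that is
   constant on (-oo,0]; this is a bijection with C(R^+,R). *)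
Definition Cset : set (R -> R) :=
  [set x : R -> R | continuous x /\ forall t : R, t < 0 -> x t = x 0].

Definition coord_gen (s : R) : set (set (R -> R)) :=
  [set A | exists r (B : set R), 0 <= r <= s /\ measurable B /\
                                 A = Cset `&` [set x | B (x r)]].
Definition sigmaX (s : R) : set (set (R -> R)) := <<s Cset, coord_gen s >>.

Definition Cfilt (t : R) : set (set (R -> R)) :=
  [set A | forall s, t < s -> sigmaX s A].

Definition Cinf : set (set (R -> R)) :=
  <<s Cset, [set A | exists r (B : set R), 0 <= r /\ measurable B /\
                                 A = Cset `&` [set x | B (x r)]] >>.

Definition Cstop (T : (R -> R) -> R) : set (set (R -> R)) :=
  [set A | Cinf A /\ forall t, 0 <= t -> Cfilt t (A `&` [set x | T x <= t])].

Definition FK (K : R) : set (R -> R) :=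
  [set b : R -> R | (forall x : R, derivable b x 1) /\ continuous (derive1 b) /\
           forall x, `|b x| + `|derive1 b x| <= K].

Definition condC (sig : R -> R) (s0 s1 Ks : R) : Prop :=
  (forall x : R, derivable sig x 1) /\ (forall x : R, derivable (derive1 sig) x 1) /\
  continuous (derive1 (derive1 sig)) /\
  0 < s0 ^+ 2 /\ (forall x, s0 ^+ 2 <= sig x ^+ 2 <= s1 ^+ 2) /\
  (forall x, `|derive1 sig x| + `|derive1 (derive1 sig) x| <= Ks).

Definition is_BM d (Om : measurableType d) (P : probability Om R)
    (W : Om -> R -> R) : Prop :=
  (forall t, measurable_fun setT (fun w => W w t)) /\
  (forall w, W w 0 = 0) /\
  (forall w, {within `[0, +oo[, continuous (W w)}) /\
  (forall (n : nat) (t : nat -> R) (A : nat -> set R),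
      t 0%N = 0 -> (forall i, (i < n)%N -> t i < t i.+1) ->
      (forall i, measurable (A i)) ->
      P (\bigcap_(i in `I_n) [set w | A i (W w (t i.+1) - W w (t i))]) =
      (\prod_(i < n) normal_prob 0 (Num.sqrt (t i.+1 - t i)) (A i))%E).

Definition indep_init d (Om : measurableType d) (P : probability Om R)
    (eta : Om -> R) (W : Om -> R -> R) : Prop :=
  forall (n : nat) (t : nat -> R) (B : set R) (A : nat -> set R),
    (forall i, 0 <= t i) -> measurable B -> (forall i, measurable (A i)) ->
    P ([set w | B (eta w)] `&` \bigcap_(i in `I_n) [set w | A i (W w (t i))]) =
    (P [set w | B (eta w)] * P (\bigcap_(i in `I_n) [set w | A i (W w (t i))]))%E.

Definition is_prob_on {T} (D : set T) (F : set (set T)) (mu : set T -> R) : Prop :=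
  (forall A, F A -> 0 <= mu A) /\ mu D = 1 /\
  (forall A : nat -> set T, (forall k, F (A k)) -> trivIset setT A ->
     (fun m => \sum_(k < m) mu (A k)) @ \oo --> mu (\bigcup_k A k)).

Definition markov_kernel {T} (D : set T) (F1 F2 : set (set T))
    (M : T -> set T -> R) : Prop :=
  (forall x, D x -> is_prob_on D F2 (M x)) /\
  (forall A, F2 A -> forall B : set R, measurable B ->
     F1 (D `&` [set x | B (M x A)])).

(* || M P_1 - P_2 ||_TV on F2, where P_i is the law of Z_i under P *)
Definition tv_kernel d (Om : measurableType d) (P : probability Om R) {T}
    (F2 : set (set T)) (M : T -> set T -> R) (Z1 Z2 : Om -> T) : \bar R :=
  ereal_sup [set `| (\int[P]_w (M (Z1 w) A)%:E) - P (Z2 @^-1` A) |%E | A in F2].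

(* deficiency delta(E, G) with E = (D, F1, (law of Z1 b)_{b in Th}),
   G = (D, F2, (law of Z2 b)_{b in Th}); the supremum over b of the
   (nonnegative) distances is taken with value 0 on an empty family. *)
Definition deficiency d (Om : measurableType d) (P : probability Om R) {T Par}
    (D : set T) (F1 F2 : set (set T)) (Th : set Par) (Z1 Z2 : Par -> Om -> T)
    : \bar R :=
  ereal_inf [set ereal_sup (0%E |` [set tv_kernel P F2 M (Z1 b) (Z2 b) | b in Th])
            | M in markov_kernel D F1 F2].

Definition lecam d (Om : measurableType d) (P : probability Om R) {T Par}
    (D : set T) (F1 F2 : set (set T)) (Th : set Par) (Z1 Z2 : Par -> Om -> T)
    : \bar R :=
  Order.max (deficiency P D F1 F2 Th Z1 Z2) (deficiency P D F2 F1 Th Z2 Z1).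

End Defs.

(* Main.v *)
Require Import Defs.
From HB Require Import structures.
From mathcomp Require Import all_boot all_order all_algebra.
From mathcomp Require Import all_classical all_reals all_analysis.
From mathcomp Require Import measurable_realfun lra.
Import Order.TTheory GRing.Theory Num.Theory.
Import numFieldNormedType.Exports.
Local Open Scope classical_set_scope.
Local Open Scope ring_scope.
Set Implicit Arguments.
Unset Strict Implicit.

(** On continuous paths the clock [rhobar _ x] is piecewise linear with slopes in
    [s0^2, s1^2], hence a bijection of the half-line with inverse [taubar _ x], and
    [x |-> x o taubar] is undone by [y |-> y o Abar], because [Abar _ y] is the
    clock [rhobar] of the path [y o Abar].  These two maps do not involve [b] and
    carry the law of the Euler scheme to that of its time change and back, so they
    serve as deterministic kernels with zero error.  It remains to see that they
    are measurable for the stopped sigma-algebras.  By Galmarino's test, an event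
    belongs to [sigmaX s] iff it is in [Cinf] and is determined by the path on
    [0, s]; since both maps are non-anticipating with respect to the clocks, the
    required measurability becomes a pathwise statement. *)

(** * Piecewise defined functions on the grid *)

Section Grid.
Context {R : realType} (h : R).
Hypothesis h0 : 0 < h.

Lemma cellP (t : R) : 0 < t ->
  (cell h t)%:R * h < t /\ t <= (cell h t).+1%:R * h.
Proof.
move=> t0; rewrite /cell.
have th0 : 0 < t / h by rewrite divr_gt0.
have c0 : 0 <= Num.ceil (t / h) - 1.
  by rewrite subr_ge0 -gtz0_ge1 ceil_gt0.
have cE : (`|Num.ceil (t / h) - 1|%N%:R : R) = (Num.ceil (t / h))%:~R - 1.
  by rewrite natr_absz ger0_norm// intrB.
rewrite -natr1 cE subrK -ltr_pdivlMr// -ler_pdivrMr// ceil_ge; split => //.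
by have := ceilB1_lt (t / h); rewrite intrB.
Qed.

Lemma ler_grid (i j : nat) : (i%:R * h <= j%:R * h) = (i <= j)%N.
Proof. by rewrite ler_pM2r// ler_nat. Qed.

Lemma ltr_grid (i j : nat) : (i%:R * h < j%:R * h) = (i < j)%N.
Proof. by rewrite ltr_pM2r// ltr_nat. Qed.

Lemma grid_ge0 (k : nat) : 0 <= k%:R * h.
Proof. by rewrite mulr_ge0// ltW. Qed.

Lemma cell_unique (k : nat) (t : R) :
  k%:R * h < t -> t <= k.+1%:R * h -> cell h t = k.
Proof.
move=> kt tk; have [] := cellP (le_lt_trans (grid_ge0 k) kt).
move=> /lt_le_trans/(_ tk); rewrite ltr_grid ltnS => ck.
move=> /(lt_le_trans kt); rewrite ltr_grid ltnS => kc.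
by apply/eqP; rewrite eqn_leq ck kc.
Qed.

(** Common form of the clock and of the Euler path: [G k] is what accumulates on cell number [k],
    counted from its left end, and the current cell is stopped at [t]. *)
Definition grid_sum (G : nat -> R -> R) (t : R) : R :=
  if 0 < t then
    let k := cell h t in \sum_(i < k) G i (i.+1%:R * h) + G k t
  else 0.

(** The projection of [t] onto the closed cell number [k]. *)
Definition clamp (k : nat) (t : R) : R :=
  Num.max (k%:R * h) (Num.min t (k.+1%:R * h)).

Lemma clamp_ge (k : nat) (t : R) : k%:R * h <= clamp k t.
Proof. by rewrite /clamp le_max lexx. Qed.

Lemma clamp_before (k : nat) (t : R) : t <= k%:R * h -> clamp k t = k%:R * h.
Proof. by move=> tk; apply/max_idPl; rewrite ge_min tk. Qed.

Lemma clamp_in (k : nat) (t : R) :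
  k%:R * h <= t -> t <= k.+1%:R * h -> clamp k t = t.
Proof. by move=> kt tk; rewrite /clamp (min_idPl tk); apply/max_idPr. Qed.

Lemma clamp_after (k : nat) (t : R) :
  k.+1%:R * h <= t -> clamp k t = k.+1%:R * h.
Proof.
by move=> kt; rewrite /clamp (min_idPr kt); apply/max_idPr; rewrite ler_grid.
Qed.

Lemma clamp_le2 (k : nat) (s t : R) : s <= t -> clamp k s <= clamp k t.
Proof. by move=> st; apply: le_max2 => //; apply: le_min2. Qed.

(** A cell after [t] contributes [G k] at its left end, which is 0, and a cell before [t]
    contributes in full. The number of terms no longer depends on [t], so continuity and
    measurability can be checked term by term. *)
Lemma grid_sum_clamp (N : nat) (G : nat -> R -> R) (t : R) :
  (forall k, G k (k%:R * h) = 0) -> t <= N%:R * h ->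
  grid_sum G t = \sum_(k < N) G k (clamp k t).
Proof.
move=> G0 tN; rewrite /grid_sum; case: ltP => t0; last first.
  by rewrite big1// => k _; rewrite clamp_before ?G0// (le_trans t0)// grid_ge0.
have [ct tc] := cellP t0; set c := cell h t in ct tc *.
have cN : (c < N)%N by rewrite -ltr_grid (lt_le_trans ct).
rewrite -(big_mkord xpredT (fun k => G k (clamp k t))).
rewrite (big_cat_nat (n := c)) ?(ltnW cN)//= (big_ltn cN) clamp_in// ?ltW//.
rewrite [X in _ = _ + (_ + X)]big1_seq ?addr0; last first.
  move=> k /=; rewrite mem_index_iota => /andP[ck _].
  by rewrite clamp_before ?G0// (le_trans tc)// ler_grid.
congr (_ + _); rewrite big_mkord; apply: eq_bigr => i _.
by rewrite clamp_after// (le_trans _ (ltW ct))// ler_grid.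
Qed.

Lemma exists_grid_gt (t : R) : exists N : nat, t < N%:R * h.
Proof.
exists (Num.truncn (t / h)).+1; rewrite -ltr_pdivrMr//.
exact: truncnS_gt.
Qed.

Lemma continuous_clamp (k : nat) : continuous (clamp k).
Proof.
have cc (c : R) : continuous (fun _ : R => c) by move=> t; exact: cvg_cst.
have idc : continuous (@idfun R) by move=> t; exact: cvg_id.
exact: (max_fun_continuous (cc _) (min_fun_continuous idc (cc _))).
Qed.

Lemma continuous_grid_sum (G : nat -> R -> R) :
  (forall k, G k (k%:R * h) = 0) ->
  (forall k, continuous (fun t => G k (clamp k t))) ->
  continuous (grid_sum G).
Proof.
move=> G0 Gc t; have [N tN] := exists_grid_gt t.
have Sc : continuous (fun t => \sum_(k < N) G k (clamp k t)).
  elim: (N) => [|m IH] s.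
    by under eq_fun do rewrite big_ord0; exact: cvg_cst.
  under eq_fun do rewrite big_ord_recr/=.
  by apply: continuousD; [exact: IH|exact: Gc].
rewrite /continuous_at (grid_sum_clamp G0 (ltW tN)).
apply: cvg_trans (Sc t); apply: near_eq_cvg; near=> s.
by apply/esym/grid_sum_clamp => //; near: s; exact: lt_le_nbhsl.
Unshelve. all: by end_near. Qed.

End Grid.

(** * The clock [rhobar] and its inverse [taubar] *)

Section Clock.
Context {R : realType} (h : R) (sig : R -> R).
Hypothesis h0 : 0 < h.

Definition clock_rate (x : R -> R) (k : nat) : R := sig (x (k%:R * h)) ^+ 2.

Lemma clamp_sub_measure (k : nat) (t : R) :
  lebesgue_measure (`]k%:R * h, k.+1%:R * h] `&` `[0, t]) =
  (clamp h k t - k%:R * h)%:E.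
Proof.
have -> : `]k%:R * h, k.+1%:R * h] `&` `[0, t] = `]k%:R * h, clamp h k t]%classic.
  apply/seteqP; split=> s /=; rewrite !in_itv/= /clamp le_max le_min.
    by move=> [/andP[-> ->] /andP[_ ->]]; rewrite orbT.
  move=> /andP[ks]; rewrite leNgt ks/= => /andP[-> ->]; split => //.
  by rewrite andbT (le_trans (grid_ge0 h0 k))// ltW.
rewrite lebesgue_measure_itv/= lte_fin; case: ltP => // ck.
by rewrite (_ : clamp h k t = k%:R * h) ?subrr//; apply/le_anti; rewrite ck clamp_ge.
Qed.

Lemma sigmah_indic (N : nat) (x : R -> R) (t s : R) :
  t <= N%:R * h -> 0 <= s <= t ->
  sigmah h sig s x ^+ 2 =
  \sum_(k < N) clock_rate x k * \1_(`]k%:R * h, k.+1%:R * h]) s.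
Proof.
(* At [s = 0] the default value 0 of [sigmah] is the right one, since no half-open cell contains
   0. *)
move=> tN /andP[s0 st]; rewrite /sigmah; case: ltP => s0'; last first.
  rewrite expr0n/= big1// => k _; rewrite indicE memNset ?mulr0//=.
  by rewrite in_itv/= ltNge (le_trans s0')// grid_ge0.
have [cs sc] := cellP h0 s0'; set c := cell h s in cs sc *.
have cN : (c < N)%N by rewrite -(ltr_grid h0) (lt_le_trans cs)// (le_trans st).
rewrite (bigD1 (Ordinal cN))//= indicE mem_set ?mulr1/=; last first.
  by rewrite /= in_itv/= cs sc.
rewrite big1 ?addr0// => k kc; rewrite indicE memNset ?mulr0//=.
rewrite in_itv/= => /andP[ks sk]; move/eqP: kc; apply; apply/val_inj => /=.
by rewrite -(cell_unique h0 ks sk).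
Qed.

(** The integral of a step function, taken cell by cell; [clamp_sub_measure] gives the length of the
    part of each cell that lies before [t]. *)
Lemma rhobarE (x : R -> R) (t : R) :
  rhobar h sig t x = grid_sum h (fun k s => clock_rate x k * (s - k%:R * h)) t.
Proof.
have [N /ltW tN] := exists_grid_gt h0 t.
rewrite (grid_sum_clamp h0 _ tN); last by move=> k; rewrite subrr mulr0.
rewrite /rhobar /Rintegral.
have mI k : measurable (`]k%:R * h, k.+1%:R * h]%classic : set R).
  exact: measurable_itv.
have r0 k : 0 <= clock_rate x k by rewrite /clock_rate sqr_ge0.
under eq_integral.
  move=> s; rewrite inE/= in_itv/= => st.
  rewrite (sigmah_indic _ tN st) -sumEFin; over.
rewrite /= ge0_integral_sum//=; first last.
- by move=> k s _; rewrite lee_fin mulr_ge0.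
- by move=> k; apply/measurable_EFinP/measurable_funM => //; exact: measurable_indic.
rewrite (eq_bigr (fun k : 'I_N => (clock_rate x k * (clamp h k t - k%:R * h))%:E)).
  by rewrite sumEFin.
move=> k _; under eq_integral do rewrite EFinM.
rewrite ge0_integralZl_EFin//=; last first.
  by apply/measurable_EFinP; exact: measurable_indic.
by rewrite integral_indic// [RHS]EFinM; congr (_ * _)%E; exact: clamp_sub_measure.
Qed.

Lemma rhobar_le0 (x : R -> R) (t : R) : t <= 0 -> rhobar h sig t x = 0.
Proof. by move=> t0; rewrite rhobarE /grid_sum ltNge t0. Qed.

(** The coefficient on a cell is frozen at its left end, so the clock at [t] reads the path only at
    grid points before [t]. *)
Lemma rhobar_eq (x x' : R -> R) (s t : R) :
  (forall r, 0 <= r <= s -> x r = x' r) -> t <= s ->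
  rhobar h sig t x = rhobar h sig t x'.
Proof.
move=> xx' ts; rewrite !rhobarE /grid_sum; case: ltP => // t0.
have [ct tc] := cellP h0 t0; rewrite /clock_rate.
have E (i : nat) : (i <= cell h t)%N -> x (i%:R * h) = x' (i%:R * h).
  move=> ic; apply: xx'; rewrite grid_ge0//= (le_trans _ ts)//.
  by rewrite (le_trans _ (ltW ct))// ler_grid.
by rewrite E//; congr (_ + _); apply: eq_bigr => i _; rewrite E// ltnW.
Qed.

Context (s0 s1 : R).
Hypothesis s00 : 0 < s0 ^+ 2.
Hypothesis sigb : forall x, s0 ^+ 2 <= sig x ^+ 2 <= s1 ^+ 2.

Lemma rhobar_increment (x : R -> R) (s t : R) : 0 <= s -> s <= t ->
  s0 ^+ 2 * (t - s) <= rhobar h sig t x - rhobar h sig s x <= s1 ^+ 2 * (t - s).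
Proof.
move=> s_ge0 st; have [N /ltW tN] := exists_grid_gt h0 t.
have sN := le_trans st tN.
(* The identity is the grid sum with rate 1. This spreads [t - s] over the same cells as the clock
   increment, and the rates can be compared cell by cell. *)
have idE r : 0 <= r -> r <= N%:R * h ->
    r = \sum_(k < N) (clamp h k r - k%:R * h).
  move=> r0 rN; rewrite -(grid_sum_clamp (G := fun k r => r - k%:R * h) h0)//.
    rewrite /grid_sum; case: ltP => [r1|r1]; last by apply/le_anti; rewrite r0 r1.
    under eq_bigr do rewrite -mulrBl -natrB// subSnn mul1r.
    by rewrite sumr_const card_ord -[h *+ _]mulr_natl; lra.
  by move=> k; rewrite subrr.
have tsE : t - s = \sum_(k < N) (clamp h k t - clamp h k s).
  rewrite [in LHS](idE t)// ?(le_trans s_ge0)// [in X in _ - X](idE s)//.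
  by rewrite -sumrB; apply: eq_bigr => k _; lra.
have rE r : r <= N%:R * h ->
    rhobar h sig r x = \sum_(k < N) clock_rate x k * (clamp h k r - k%:R * h).
  move=> rN; rewrite rhobarE (grid_sum_clamp h0 _ rN)// => k.
  by rewrite subrr mulr0.
rewrite (rE t)// (rE s)// -sumrB tsE !mulr_sumr; apply/andP; split;
  apply: ler_sum => k _; rewrite -mulrBr opprB addrA subrK.
all: by rewrite ler_wpM2r// ?subr_ge0 ?clamp_le2// ; have /andP[] := sigb (x (k%:R * h)).
Qed.

Lemma rhobar_lt (x : R -> R) (s t : R) : 0 <= s -> s < t ->
  rhobar h sig s x < rhobar h sig t x.
Proof.
move=> s_ge0 st; rewrite -subr_gt0.
have /andP[+ _] := rhobar_increment x s_ge0 (ltW st); apply: lt_le_trans.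
by rewrite mulr_gt0// subr_gt0.
Qed.

Lemma rhobar_le (x : R -> R) (s t : R) : 0 <= s -> s <= t ->
  rhobar h sig s x <= rhobar h sig t x.
Proof.
move=> s_ge0; rewrite le_eqVlt => /predU1P[->//|st].
by rewrite ltW// rhobar_lt.
Qed.

Lemma ler_rhobar (x : R -> R) (s t : R) : 0 <= s -> 0 <= t ->
  (rhobar h sig s x <= rhobar h sig t x) = (s <= t).
Proof.
move=> s_ge0 t_ge0; apply/idP/idP; last exact: rhobar_le.
by apply: contraLR; rewrite -!ltNge; exact: rhobar_lt.
Qed.

Lemma rhobar_ge0 (x : R -> R) (t : R) : 0 <= rhobar h sig t x.
Proof.
have [t0|/ltW t0] := leP t 0; first by rewrite rhobar_le0.
by rewrite -(rhobar_le0 x (lexx 0)) rhobar_le.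
Qed.

Lemma continuous_rhobar (x : R -> R) : continuous (rhobar h sig ^~ x).
Proof.
rewrite (_ : rhobar h sig ^~ x =
  grid_sum h (fun k s => clock_rate x k * (s - k%:R * h))); last first.
  by apply/funext => t; rewrite rhobarE.
apply: continuous_grid_sum => // k; first by rewrite subrr mulr0.
move=> t; apply: cvgM; first exact: cvg_cst.
by apply: cvgB; [exact: continuous_clamp|exact: cvg_cst].
Qed.

Lemma rhobar_onto (x : R -> R) (u : R) : 0 <= u ->
  exists2 t, 0 <= t & rhobar h sig t x = u.
Proof.
(* The clock runs at rate at least [s0 ^+ 2], so it has reached [u] by the time [T]. *)
move=> u0; set T := u / s0 ^+ 2.
have T0 : 0 <= T by rewrite divr_ge0// ltW.
have r0 : rhobar h sig 0 x = 0 by exact: rhobar_le0.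
have uT : u <= rhobar h sig T x.
  have /andP[+ _] := rhobar_increment x (lexx 0) T0.
  by rewrite r0 !subr0 mulrC divfK// gt_eqF.
have [||t] := @IVT R (rhobar h sig ^~ x) 0 T u T0.
- by apply: continuous_subspaceT; exact: continuous_rhobar.
- by rewrite r0 (min_idPl _) ?(max_idPr _) ?u0 ?(le_trans u0).
by rewrite in_itv/= => /andP[t0 _] <-; exists t.
Qed.

(** Strict monotonicity of the clock makes [t] the least element of the set whose infimum defines
    [taubar]. *)
Lemma taubar_rhobar (x : R -> R) (t : R) : 0 <= t ->
  taubar h sig (rhobar h sig t x) x = t.
Proof.
move=> t0; rewrite /taubar.
set E := [set _ | _]; have lbE : lbound E t.
  by move=> s [s_ge0]; rewrite ler_rhobar.
have Et : E t by [].
apply/le_anti/andP; split.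
  by apply: ge_inf => //; exists t.
by apply: lb_le_inf => //; exists t.
Qed.

Lemma taubar_spec (x : R -> R) (u : R) : 0 <= u ->
  0 <= taubar h sig u x /\ rhobar h sig (taubar h sig u x) x = u.
Proof. by move=> /(rhobar_onto x)[t t0 <-]; rewrite taubar_rhobar. Qed.

(** The defining set is then the whole half-line. The value agrees with the constant extension of
    paths to negative times. *)
Lemma taubar_le0 (x : R -> R) (u : R) : u <= 0 -> taubar h sig u x = 0.
Proof.
move=> u0; rewrite /taubar.
have -> : [set t | 0 <= t /\ u <= rhobar h sig t x] = `[0, +oo[%classic.
  apply/seteqP; split=> t /=; rewrite in_itv/= andbT; first by case.
  by move=> t0; rewrite (le_trans u0)// rhobar_ge0.
by rewrite inf_itv.
Qed.

Lemma taubar_ge0 (x : R -> R) (u : R) : 0 <= taubar h sig u x.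
Proof.
have [u0|/ltW u0] := leP u 0; first by rewrite taubar_le0.
by have [] := taubar_spec x u0.
Qed.

(** The Galois connection between the clock and its inverse, for all real [u]; it turns events about
    [taubar] into events about [rhobar]. *)
Lemma taubar_leP (x : R -> R) (u t : R) : 0 <= t ->
  (taubar h sig u x <= t) = (u <= rhobar h sig t x).
Proof.
move=> t0; have [u0|/ltW u0] := leP u 0.
  by rewrite taubar_le0// t0 (le_trans u0)// rhobar_ge0.
have [tau0 tauE] := taubar_spec x u0.
by rewrite -[in RHS]tauE ler_rhobar.
Qed.

Lemma taubar_lt (x : R -> R) (u v : R) : 0 <= u -> u < v ->
  taubar h sig u x < taubar h sig v x.
Proof.
move=> u0 uv; rewrite ltNge taubar_leP ?taubar_ge0//.
by have [_ ->] := taubar_spec x u0; rewrite -ltNge.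
Qed.

(** The clock has slope at least [s0 ^+ 2], so its inverse has slope at most the reciprocal;
    [taubar] is constant on negative levels, which reduces them to level 0. *)
Lemma taubar_lipschitz (x : R -> R) (u v : R) : u <= v ->
  taubar h sig v x - taubar h sig u x <= (v - u) / s0 ^+ 2.
Proof.
have key a b : 0 <= a -> a <= b ->
    taubar h sig b x - taubar h sig a x <= (b - a) / s0 ^+ 2.
  move=> a0 ab; rewrite ler_pdivlMr// mulrC.
  have [ta aE] := taubar_spec x a0; have [tb bE] := taubar_spec x (le_trans a0 ab).
  have tab : taubar h sig a x <= taubar h sig b x by rewrite taubar_leP// bE.
  by have /andP[+ _] := rhobar_increment x ta tab; rewrite aE bE.
move=> uv; have [u0|/ltW u0] := leP u 0; last exact: key.
have [v0|/ltW v0] := leP v 0.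
  by rewrite !taubar_le0// subrr divr_ge0 ?subr_ge0// ltW.
rewrite (taubar_le0 _ u0) -(taubar_le0 x (lexx 0)) (le_trans (key _ _ (lexx 0) v0))//.
by rewrite ler_pM2r ?invr_gt0//; lra.
Qed.

Lemma taubar_le2 (x : R -> R) (u v : R) : u <= v ->
  taubar h sig u x <= taubar h sig v x.
Proof.
move=> uv; rewrite taubar_leP ?taubar_ge0// (le_trans uv)//.
have [v0|/ltW v0] := leP v 0; first by rewrite (le_trans v0)// rhobar_ge0.
by have [_ ->] := taubar_spec x v0.
Qed.

Lemma continuous_taubar (x : R -> R) : continuous (taubar h sig ^~ x).
Proof.
move=> u; apply/cvgrPdist_le => e e0; near=> v.
have uv : `|u - v| <= e * s0 ^+ 2.
  near: v; apply: (@cvgr_dist_le _ _ _ (nbhs u) _ id) => //.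
  by rewrite mulr_gt0.
rewrite -ler_pdivrMr// in uv; apply: le_trans uv.
have [le_uv|/ltW le_vu] := leP u v.
  rewrite distrC [in leRHS]distrC !ger0_norm ?subr_ge0 ?taubar_le2//.
  exact: taubar_lipschitz.
by rewrite !ger0_norm ?subr_ge0 ?taubar_le2//; exact: taubar_lipschitz.
Unshelve. all: by end_near. Qed.

End Clock.

(** * Path space *)

Section GeneratedSigmaAlgebra.
Context {T : Type} (D : set T) (G : set (set T)).

Lemma sigma_algebra_subD : (forall A, G A -> A `<=` D) ->
  forall A, <<s D, G >> A -> A `<=` D.
Proof.
move=> GD; apply: (@smallest_sub _ (sigma_algebra D) G [set A | A `<=` D]) => //.
split=> [|A _|A AD] /=; [exact: sub0set|exact: subDsetl|].
by apply: bigcup_sub => k _; exact: AD.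
Qed.

(** The sets with preimage in [F] form a sigma-algebra. Complements are relative to [D] and [E],
    hence the condition that [f] sends [E] into [D]. *)
Lemma preimage_sigma_algebra {T'} (E : set T') (F : set (set T')) (f : T' -> T) :
  sigma_algebra E F -> (forall w, E w -> D (f w)) ->
  (forall A, G A -> F (E `&` f @^-1` A)) ->
  forall A, <<s D, G >> A -> F (E `&` f @^-1` A).
Proof.
move=> [F0 FD FU] fED GF.
apply: (@smallest_sub _ (sigma_algebra D) G [set A | F (E `&` f @^-1` A)]) => //.
split=> [|A FA|A FA] /=.
- by rewrite preimage_set0 setI0.
- have -> : E `&` f @^-1` (D `\` A) = E `\` (E `&` f @^-1` A).
    apply/seteqP; split=> w /= [Ew].
      by move=> [_ nA]; split=> // -[].
    by move=> nA; split=> //; split; [exact: fED|move=> ?; exact: nA].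
  exact: FD.
- by rewrite preimage_bigcup setI_bigcupr; exact: FU.
Qed.

End GeneratedSigmaAlgebra.

(** A separate name for the function type, to which the sigma-algebra of paths is attached as a
    canonical structure. *)
Definition real_path (R : realType) : Type := R -> R.

Fact path_display : measure_display. Proof. exact: default_measure_display. Qed.

Section PathSpace.
Context {R : realType}.

HB.instance Definition _ := Pointed.copy (real_path R) (R -> R).

(* A set is declared measurable when its trace on [Cset] is in [Cinf]: this is
   a sigma-algebra on the type of all functions, of which [Cset] is a measurable
   subset carrying exactly [Cinf]. *)
Definition path_measurable : set (set (real_path R)) := [set A | Cinf (Cset `&` A)].

Let path_measurable0 : path_measurable set0.
Proof. by rewrite /path_measurable/= setI0; exact: sigma_algebra0. Qed.

Let path_measurableC A : path_measurable A -> path_measurable (~` A).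
Proof.
rewrite /path_measurable/= => /sigma_algebraCD.
by rewrite setDIr setDv set0U setDE.
Qed.

Let path_measurable_bigcup (F : (set (real_path R))^nat) :
  (forall i, path_measurable (F i)) -> path_measurable (\bigcup_i F i).
Proof.
move=> mF; rewrite /path_measurable/= setI_bigcupr.
exact: sigma_algebra_bigcup.
Qed.

HB.instance Definition _ := @isMeasurable.Build path_display (real_path R)
  path_measurable path_measurable0 path_measurableC path_measurable_bigcup.

Lemma Cinf_sub (A : set (R -> R)) : Cinf A -> A `<=` Cset.
Proof. by apply: sigma_algebra_subD => B [r [C [_ [_ ->]]]] x []. Qed.

Lemma CinfP (A : set (R -> R)) :
  Cinf A <-> measurable (A : set (real_path R)) /\ A `<=` Cset.
Proof.
split=> [CA|[mA sAC]]; last by rewrite -(setIidr sAC).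
have sAC := Cinf_sub CA; split=> //.
by rewrite /measurable/= /path_measurable/= (setIidr sAC).
Qed.

Lemma Cinf_measurable (A : set (R -> R)) : Cinf A -> measurable (A : set (real_path R)).
Proof. by move=> /CinfP[]. Qed.

Lemma measurable_Cset : measurable (Cset : set (real_path R)).
Proof.
rewrite /measurable/= /path_measurable/= setIid -[X in Cinf X]setD0.
by apply: sigma_algebraCD; exact: sigma_algebra0.
Qed.

Lemma Cset_le0 (x : R -> R) (t : R) : Cset x -> t <= 0 -> x t = x 0.
Proof. by move=> [_ x0]; rewrite le_eqVlt => /predU1P[->//|/x0]. Qed.

Lemma measurable_coord (r : R) : measurable_fun (Cset : set (real_path R)) (fun x => x r).
Proof.
wlog r0 : r / 0 <= r.
  move=> wlg; have [|/ltW r0] := leP 0 r; first exact: wlg.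
  apply: eq_measurable_fun (wlg 0 (lexx 0)) => x /set_mem Cx.
  by rewrite (Cset_le0 Cx r0).
move=> _ B mB; apply: Cinf_measurable; apply: sub_sigma_algebra.
by exists r, B.
Qed.

Lemma Cinf_preimage d (T : measurableType d) (E : set T) (Z : T -> R -> R) :
  measurable E -> (forall w, E w -> Cset (Z w)) ->
  (forall r, 0 <= r -> measurable_fun E (Z^~ r)) ->
  forall A, Cinf A -> measurable (E `&` Z @^-1` A).
Proof.
move=> mE ZC mZ; apply: preimage_sigma_algebra => //.
  by split=> [|A mA|A mA] //; [exact: measurableD|exact: bigcupT_measurable].
move=> _ [r [B [r0 [mB ->]]]].
have -> : E `&` Z @^-1` (Cset `&` [set x | B (x r)]) = E `&` (Z^~ r) @^-1` B.
  by apply/seteqP; split=> w /= [Ew]; [move=> []|split=> //; split=> //; exact: ZC].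
exact: mZ.
Qed.

Lemma Cset_comp (x f : R -> R) : Cset x -> continuous f ->
  (forall t, t <= 0 -> f t <= 0) -> Cset (x \o f).
Proof.
move=> Cx cf f0; split=> [t|t /ltW t0].
  by apply: continuous_comp; [exact: cf|exact: Cx.1].
by rewrite /= !(Cset_le0 Cx) ?f0.
Qed.

(** * Galmarino's test and stopped sigma-algebras *)

Definition determined_until (s : R) (A : set (R -> R)) : Prop :=
  forall x x', Cset x -> Cset x' -> (forall r, 0 <= r <= s -> x r = x' r) ->
  A x -> A x'.

(* Galmarino's test *)
Lemma sigmaXP (s : R) (A : set (R -> R)) : 0 <= s ->
  sigmaX s A <-> Cinf A /\ determined_until s A.
Proof.
move=> s0; split=> [sA|[CA dA]].
  split.
    apply: smallest_sub sA; first exact: smallest_sigma_algebra.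
    move=> _ [r [B [/andP[r0 _] [mB ->]]]]; apply: sub_sigma_algebra.
    by exists r, B.
  (* The equivalence, unlike the implication, is stable under complements. *)
  suff : forall x x', Cset x -> Cset x' ->
      (forall r, 0 <= r <= s -> x r = x' r) -> A x <-> A x'.
    by move=> AA x x' Cx Cx' /(AA _ _ Cx Cx')[].
  move=> x x' Cx Cx' xx'; move: A sA.
  apply: (@smallest_sub _ (sigma_algebra Cset) _ [set A | A x <-> A x']).
    split=> [|A [Axx' Ax'x]|A AA] /=; first by [].
      by split=> -[_ nA]; split=> //; [move/Ax'x|move/Axx'].
    by split=> -[k _] /AA ?; exists k.
  by move=> _ [r [B [rs [_ ->]]]] /=; rewrite (xx' r rs); split=> -[].
(* Conversely, [A] is its own preimage under stopping the path at [s], and a coordinate of the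
   stopped path is a coordinate at a time at most [s]. *)
pose stopped (x : R -> R) : R -> R := x \o Num.min^~ s.
have stC x : Cset x -> Cset (stopped x).
  move=> Cx; apply: Cset_comp => //.
    have idc : continuous (@idfun R) by move=> t; exact: cvg_id.
    have cs : continuous (fun _ : R => s) by move=> t; exact: cvg_cst.
    exact: (min_fun_continuous idc cs).
  by move=> t t0; rewrite ge_min t0.
have -> : A = Cset `&` stopped @^-1` A.
  apply/seteqP; split=> x /=.
    move=> Ax; have Cx := Cinf_sub CA Ax; split=> //.
    apply: dA Ax => //; first exact: stC.
    by move=> r /andP[_ rs]; rewrite /stopped/= (min_idPl rs).
  move=> [Cx]; apply: dA => //; first exact: stC.
  by move=> r /andP[_ rs]; rewrite /stopped/= (min_idPl rs).
move: A CA {dA}; apply: preimage_sigma_algebra => //.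
  exact: smallest_sigma_algebra.
move=> _ [r [B [r0 [mB ->]]]]; apply: sub_sigma_algebra.
exists (Num.min r s), B; split; first by rewrite le_min r0 s0 ge_min lexx orbT.
split=> //; apply/seteqP; split=> x /= [Cx]; first by case.
by move=> Bx; split=> //; split=> //; exact: stC.
Qed.

(** Galmarino's test under the intersection over [s > t] that makes the filtration right-continuous:
    membership in [Cinf] does not involve [s], and only the pathwise condition does. *)
Lemma CstopP (S : (R -> R) -> R) (A : set (R -> R)) :
  Cstop S A <-> Cinf A /\ forall t, 0 <= t ->
    Cinf (A `&` [set x | S x <= t]) /\
    forall s, t < s -> determined_until s (A `&` [set x | S x <= t]).
Proof.
split=> -[CA AS]; split=> // t t0.
  have {}AS s : t < s -> Cinf (A `&` [set x | S x <= t]) /\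
                          determined_until s (A `&` [set x | S x <= t]).
    by move=> ts; apply/sigmaXP; [exact/ltW/(le_lt_trans t0)|exact: AS].
  split; first by have [|//] := AS (t + 1); rewrite ltrDl.
  by move=> s /AS[].
move=> s ts; have [? dA] := AS t t0; apply/sigmaXP.
  exact/ltW/(le_lt_trans t0).
by split=> //; exact: dA.
Qed.

(** [Cstop S Cset] says that [S] is a stopping time. It carries [S x <= t] over to [x'], after which
    the test for [A] is used from [x'] back to [x]. *)
Lemma Cstop_setD (S : (R -> R) -> R) (A : set (R -> R)) :
  Cstop S Cset -> Cstop S A -> Cstop S (Cset `\` A).
Proof.
move=> /CstopP[_ SD] /CstopP[CA SA]; apply/CstopP; split.
  exact: sigma_algebraCD.
move=> t t0; have [DT dD] := SD t t0; have [AT dA] := SA t t0.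
have E : (Cset `\` A) `&` [set x | S x <= t] =
    (Cset `&` [set x | S x <= t]) `\` (A `&` [set x | S x <= t]).
  apply/seteqP; split=> x /=; first by move=> [[Cx nA] Sx]; split=> // -[].
  by move=> [[Cx Sx] nA]; split=> //; split=> // Ax; exact: nA.
split.
  rewrite E; apply/CinfP; split; last by move=> x [[]].
  by apply: measurableD; exact: Cinf_measurable.
move=> s ts x x' Cx Cx' xx' [[_ nA] Sx].
have [_ Sx'] := dD s ts x x' Cx Cx' xx' (conj Cx Sx).
split=> //; split=> // Ax'; apply: nA.
by have [] := dA s ts x' x Cx' Cx (fun r rs => esym (xx' r rs)) (conj Ax' Sx').
Qed.

Lemma Cstop_cst (a : R) : Cstop (fun=> a) Cset.
Proof.
apply/CstopP; have CC : Cinf (Cset : set (R -> R)).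
  by apply/CinfP; split=> //; exact: measurable_Cset.
split=> // t t0; have [ta|ta] := leP a t.
  rewrite (_ : [set x | true] = setT) ?setIT; last first.
    by apply/seteqP; split.
  by split=> // s _ x x' _ Cx'.
rewrite (_ : [set x | false] = set0) ?setI0; last first.
  by apply/seteqP; split.
by split=> [|s _ x x' //]; exact: sigma_algebra0.
Qed.

(* Non-anticipation: [f x], run until the time [c x s], only depends on [x]
   until the time [s]. *)
Lemma time_change_Cstop (f : (R -> R) -> R -> R) (c : (R -> R) -> R -> R)
    (S S' : (R -> R) -> R) (A : set (R -> R)) :
  (forall x, Cset x -> Cset (f x)) ->
  (forall r, 0 <= r -> measurable_fun (Cset : set (real_path R)) (fun x => f x r)) ->
  (forall x s t, 0 <= s -> s < t -> c x s < c x t) ->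
  (forall x s, 0 <= c x s) ->
  (forall x x' s, Cset x -> Cset x' -> 0 <= s ->
    (forall r, 0 <= r <= s -> x r = x' r) ->
    (forall r, 0 <= r <= s -> c x r = c x' r) /\
    (forall r, 0 <= r <= c x s -> f x r = f x' r)) ->
  measurable_fun (Cset : set (real_path R)) S ->
  (forall x, Cset x -> 0 <= S x) ->
  (forall x, Cset x -> S' (f x) = c x (S x)) ->
  Cstop S' A -> Cstop S (Cset `&` f @^-1` A).
Proof.
move=> fC mf c_lt c_ge0 fc mS S0 SS' /CstopP[CA SA].
have mfA : measurable (Cset `&` f @^-1` A : set (real_path R)).
  by apply: Cinf_preimage => //; exact: measurable_Cset.
apply/CstopP; split; first by apply/CinfP; split=> // x [].
move=> t t0; split.
  apply/CinfP; split; last by move=> x [[]].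
  have -> : (Cset `&` f @^-1` A) `&` [set x | S x <= t] =
      (Cset `&` f @^-1` A) `&` (Cset `&` S @^-1` `]-oo, t]).
    apply/seteqP; split=> x /=; rewrite in_itv/=; first by move=> [[]].
    by move=> [? []].
  by apply: measurableI => //; apply: mS => //; exact: measurable_Cset.
move=> s ts x x' Cx Cx' xx' [[_ Ax] Sx].
have s0 : 0 <= s by rewrite ltW// (le_lt_trans t0).
have [cc ff] := fc x x' s Cx Cx' s0 xx'.
have Sxs : S x < s by rewrite (le_lt_trans Sx).
have S'x0 : 0 <= S' (f x) by rewrite SS'.
(* Test [A] at the time [S' (f x) = c x (S x)], which is strictly below the horizon [c x s] because
   [S x < s]. *)
have [_ /(_ (c x s)) dA] := SA _ S'x0.
have [|Ax' S'x'] := dA _ (f x) (f x') (fC _ Cx) (fC _ Cx') ff (conj Ax (lexx _)).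
  by rewrite SS'// c_lt// S0.
(* If [S x < S x'], the strictly increasing clock of [x'] would put [S' (f x')] above
   [c x' (S x) = c x (S x) = S' (f x)]. *)
split=> //; rewrite /= (le_trans _ Sx)// leNgt; apply/negP => SxSx'.
have ccS : c x (S x) = c x' (S x) by apply: cc; rewrite S0// ltW.
by move: S'x'; rewrite /= !SS'// ccS leNgt c_lt// S0.
Qed.

End PathSpace.

(** Round the random time down to a multiple of [1 / m.+1]: the value there is measurable by a
    countable case distinction, and it converges as [m] grows because the paths are continuous. *)
Lemma measurable_random_time (R : realType) d (T : measurableType d) (E : set T)
    (V : T -> R -> R) (tau : T -> R) :
  measurable E -> (forall t, measurable_fun E (V^~ t)) ->
  (forall w, E w -> continuous (V w)) -> measurable_fun E tau ->
  measurable_fun E (fun w => V w (tau w)).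
Proof.
move=> mE mV cV mtau.
pose fl (m : nat) (t : R) : R := (Num.floor (t * m.+1%:R))%:~R / m.+1%:R.
apply: (@measurable_fun_cvg _ _ _ _ (fun m w => V w (fl m (tau w)))).
  move=> m _ Y mY.
  have -> : E `&` (fun w => V w (fl m (tau w))) @^-1` Y =
      \bigcup_(z in [set: int]) ((E `&` tau @^-1`
         `[z%:~R / m.+1%:R, (z + 1)%:~R / m.+1%:R[) `&`
         (E `&` (V^~ (z%:~R / m.+1%:R)) @^-1` Y)).
    apply/seteqP; split=> w /=.
      move=> [Ew Yw]; exists (Num.floor (tau w * m.+1%:R)) => //=.
      rewrite in_itv/= ler_pdivrMr// ltr_pdivlMr//.
      by rewrite floor_le floorD1_gt.
    move=> [z _ /= [[Ew]]]; rewrite in_itv/= ler_pdivrMr// ltr_pdivlMr// => tz.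
    by move=> [_ Yw]; split=> //; rewrite /fl (floor_def tz).
  apply: countable_bigcupT_measurable => [|z]; first exact: countableP.
  apply: measurableI; first exact: mtau.
  exact: mV.
move=> w Ew; apply: continuous_cvg; first exact: cV.
apply/cvgrPdist_le => e e0; near=> m.
rewrite /fl; set y := tau w * _.
have yE : tau w = y / m.+1%:R by rewrite mulfK.
rewrite {1}yE -mulrBl ger0_norm; last first.
  by rewrite mulr_ge0// subr_ge0 floor_le.
rewrite ler_pdivrMr//; apply: (@le_trans _ _ 1).
  by rewrite lerBlDl; have := floorD1_gt y; rewrite intrD => /ltW.
rewrite -ler_pdivrMl// mulr1 -natr1 (@le_trans _ _ m%:R)// ?lerDl//; near: m.
exact: nbhs_infty_ger.
Unshelve. all: by end_near. Qed.

(** * The time changes *)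

Section TimeChange.
Context {R : realType} (h : R) (sig : R -> R) (s0 s1 : R).
Hypothesis h0 : 0 < h.
Hypothesis s00 : 0 < s0 ^+ 2.
Hypothesis sigb : forall x, s0 ^+ 2 <= sig x ^+ 2 <= s1 ^+ 2.

Definition time_change (x : R -> R) : R -> R := fun u => x (taubar h sig u x).

Definition time_change_inv (y : R -> R) : R -> R := fun t => y (Abar h sig t y).

Lemma rhobar_cell (x : R -> R) (k : nat) (t : R) :
  k%:R * h <= t -> t <= k.+1%:R * h ->
  rhobar h sig t x = rhobar h sig (k%:R * h) x + clock_rate h sig x k * (t - k%:R * h).
Proof.
move=> kt tk; pose G i s := clock_rate h sig x i * (s - i%:R * h).
have G0 i : G i (i%:R * h) = 0 by rewrite /G subrr mulr0.
rewrite !rhobarE// (grid_sum_clamp h0 G0 tk) (grid_sum_clamp h0 G0 (lexx _)).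
rewrite big_ord_recr/= clamp_in//; congr (_ + _); apply: eq_bigr => i _.
by rewrite !clamp_after// ?(le_trans _ kt)// ler_grid.
Qed.

Lemma Abar_grid (y : R -> R) (k : nat) : Abar h sig (k%:R * h) y = Agrid h sig y k.
Proof.
case: k => [|k]; first by rewrite mul0r /Abar ltxx.
have k0 : 0 < k.+1%:R * h by rewrite mulr_gt0.
have kk : k%:R * h < k.+1%:R * h by rewrite ltr_grid.
rewrite /Abar k0 (cell_unique h0 kk (lexx _)) /=.
by rewrite -mulrBl -natrB// subSnn mul1r.
Qed.

(* The hypothesis is an induction step, as [y] is only known to agree with [x]
   after the time change once the two clocks agree. *)
Lemma Abar_rhobar (x y : R -> R) :
  (forall k, Agrid h sig y k = rhobar h sig (k%:R * h) x ->
             y (Agrid h sig y k) = x (k%:R * h)) ->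
  forall t, Abar h sig t y = rhobar h sig t x.
Proof.
move=> yx.
have Agr k : Agrid h sig y k = rhobar h sig (k%:R * h) x.
  elim: k => [|k IH]; first by rewrite mul0r rhobar_le0.
  have kk : k%:R * h <= k.+1%:R * h by rewrite ler_grid.
  rewrite (rhobar_cell x kk (lexx _)) -IH -mulrBl -natrB// subSnn mul1r /=.
  by rewrite yx.
move=> t; rewrite /Abar; case: ltP => t0; last by rewrite rhobar_le0.
have [ct tc] := cellP h0 t0; rewrite yx// Agr.
by rewrite [RHS](rhobar_cell x (ltW ct) tc).
Qed.

Lemma Abar_time_change_inv (y : R -> R) (t : R) :
  Abar h sig t y = rhobar h sig t (time_change_inv y).
Proof. by apply: Abar_rhobar => k _; rewrite /time_change_inv Abar_grid. Qed.

Lemma Abar_time_change (x : R -> R) (t : R) :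
  Abar h sig t (time_change x) = rhobar h sig t x.
Proof.
apply: Abar_rhobar => k ->.
by rewrite /time_change (taubar_rhobar h0 s00 sigb) ?grid_ge0.
Qed.

Lemma time_changeK (x : R -> R) : Cset x -> time_change_inv (time_change x) = x.
Proof.
move=> Cx; apply/funext => t; rewrite /time_change_inv Abar_time_change /time_change.
have [t0|/ltW t0] := leP 0 t; first by rewrite (taubar_rhobar h0 s00 sigb).
by rewrite rhobar_le0// (taubar_le0 h0 s00 sigb)// (Cset_le0 Cx t0).
Qed.

Lemma Cset_time_change (x : R -> R) : Cset x -> Cset (time_change x).
Proof.
move=> Cx; apply: (Cset_comp (f := taubar h sig ^~ x) Cx).
  exact: (continuous_taubar h0 s00 sigb).
by move=> t t0; rewrite (taubar_le0 h0 s00 sigb).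
Qed.

Lemma Cset_time_change_inv (y : R -> R) : Cset y -> Cset (time_change_inv y).
Proof.
move=> Cy; apply: (Cset_comp (f := Abar h sig ^~ y) Cy).
  rewrite (_ : Abar h sig ^~ y = rhobar h sig ^~ (time_change_inv y)).
    exact: continuous_rhobar.
  by apply/funext => t; rewrite Abar_time_change_inv.
by move=> t t0; rewrite /Abar ltNge t0.
Qed.

(** A level [u] below the clock of [x] at [s] is reached before [s], where both paths have the same
    clock; hence they reach it at the same time. *)
Lemma time_change_local (x x' : R -> R) (s : R) : 0 <= s ->
  (forall r, 0 <= r <= s -> x r = x' r) ->
  (forall r, 0 <= r <= s -> rhobar h sig r x = rhobar h sig r x') /\
  (forall u, 0 <= u <= rhobar h sig s x -> time_change x u = time_change x' u).
Proof.
move=> s_ge0 xx'; split=> [r /andP[_ rs]|u /andP[u0 us]].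
  exact: (rhobar_eq sig h0 xx').
have [tau0 tauE] := taubar_spec h0 s00 sigb x u0.
have taus : taubar h sig u x <= s by rewrite (taubar_leP h0 s00 sigb).
have tauE' : rhobar h sig (taubar h sig u x) x' = u.
  by rewrite -[RHS]tauE; apply/esym/(rhobar_eq sig h0 xx').
rewrite /time_change -[in X in _ = x' X]tauE' (taubar_rhobar h0 s00 sigb)//.
by apply: xx'; rewrite tau0.
Qed.

Lemma Agrid_ge0 (y : R -> R) (k : nat) : 0 <= Agrid h sig y k.
Proof. by elim: k => //= k IH; rewrite addr_ge0// mulr_ge0 ?sqr_ge0// ltW. Qed.

(** [Abar] reads the path only at the values [Agrid], which increase towards [Abar h sig t y]. A
    bound for [y] alone thus suffices, as the recursions for [y] and [y'] never separate. *)
Lemma Abar_local (y y' : R -> R) (s t : R) :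
  (forall r, 0 <= r <= s -> y r = y' r) -> Abar h sig t y <= s ->
  Abar h sig t y = Abar h sig t y'.
Proof.
move=> yy'.
have sqh (z : R) (k : R) : 0 <= k -> 0 <= sig z ^+ 2 * k.
  by move=> k0; rewrite mulr_ge0// sqr_ge0.
have Agr k : Agrid h sig y k <= s -> Agrid h sig y k = Agrid h sig y' k.
  elim: k => //= k IH As.
  have Aks : Agrid h sig y k <= s by rewrite (le_trans _ As)// lerDl sqh// ltW.
  by rewrite -IH// yy'// Agrid_ge0.
rewrite /Abar; case: ltP => // t0 As; have [ct _] := cellP h0 t0.
have Acs : Agrid h sig y (cell h t) <= s.
  by rewrite (le_trans _ As)// lerDl sqh// subr_ge0 ltW.
by rewrite -Agr// yy'// Agrid_ge0.
Qed.

Lemma time_change_inv_local (y y' : R -> R) (s : R) : 0 <= s ->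
  (forall r, 0 <= r <= s -> y r = y' r) ->
  (forall u, 0 <= u <= s ->
     taubar h sig u (time_change_inv y) = taubar h sig u (time_change_inv y')) /\
  (forall r, 0 <= r <= taubar h sig s (time_change_inv y) ->
     time_change_inv y r = time_change_inv y' r).
Proof.
move=> s_ge0 yy'; split=> [u /andP[u0 us]|r /andP[r0 rs]].
  have [tau0 tauE] := taubar_spec h0 s00 sigb (time_change_inv y) u0.
  (* The clock rebuilt from [y'] also shows [u] at the time found for [y], so inverting it gives
     that same time. *)
  have uE : Abar h sig (taubar h sig u (time_change_inv y)) y' = u.
    rewrite -(Abar_local (s := s) yy') Abar_time_change_inv tauE//.
  by rewrite -[in RHS]uE Abar_time_change_inv (taubar_rhobar h0 s00 sigb).
have As : Abar h sig r y <= s.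
  have [_ tauE] := taubar_spec h0 s00 sigb (time_change_inv y) s_ge0.
  by rewrite Abar_time_change_inv -[leRHS]tauE (rhobar_le h0 s00 sigb).
rewrite /time_change_inv -(Abar_local yy' As); apply: yy'.
by rewrite As Abar_time_change_inv (rhobar_ge0 h0 s00 sigb).
Qed.

(** * Measurability of the time changes *)

Hypothesis sigc : continuous sig.

Let msig : measurable_fun setT sig := continuous_measurable_fun sigc.
Let mC := @measurable_Cset R.

Lemma measurable_rhobar (t : R) :
  measurable_fun (Cset : set (real_path R)) (fun x => rhobar h sig t x).
Proof.
have [N /ltW tN] := exists_grid_gt h0 t.
have rE x : rhobar h sig t x =
    \sum_(k < N) clock_rate h sig x k * (clamp h k t - k%:R * h).
  by rewrite rhobarE// (grid_sum_clamp h0 _ tN)// => k; rewrite subrr mulr0.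
under eq_fun do rewrite rE.
apply: measurable_sum => k; apply: measurable_funM => //.
apply: measurable_funX; apply: (measurableT_comp msig).
exact: measurable_coord.
Qed.

Lemma measurable_taubar (u : R) :
  measurable_fun (Cset : set (real_path R)) (fun x => taubar h sig u x).
Proof.
move=> _; apply: (measurability _ (RGenOInfty.measurableE R)) => //.
(* For [t < 0] the event that [taubar] exceeds [t] is everything; otherwise it says that the clock
   at [t] is still below [u]. *)
move=> _ [_ [t ->] <-]; have [t0|t0] := leP 0 t; last first.
  rewrite (_ : _ @^-1` _ = setT) ?setIT//; apply/seteqP; split=> // x _ /=.
  by rewrite in_itv/= andbT (lt_le_trans t0)// (taubar_ge0 h0 s00 sigb).
rewrite (_ : _ `&` _ = Cset `&` (rhobar h sig t) @^-1` `]-oo, u[).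
  by apply: measurable_rhobar.
apply/seteqP; split=> x /= [Cx]; rewrite !in_itv/= andbT ltNge.
  by rewrite (taubar_leP h0 s00 sigb)// -ltNge.
by rewrite -(taubar_leP h0 s00 sigb)// -ltNge.
Qed.

Lemma measurable_time_change (u : R) :
  measurable_fun (Cset : set (real_path R)) (fun x => time_change x u).
Proof.
apply: (measurable_random_time (V := fun x : real_path R => x)) => //.
- exact: measurable_coord.
- by move=> x [].
- exact: measurable_taubar.
Qed.

(** Each new value reads the path at the previous one, which is itself random; hence an induction
    through [measurable_random_time]. *)
Lemma measurable_Agrid (k : nat) :
  measurable_fun (Cset : set (real_path R)) (fun y => Agrid h sig y k) /\
  measurable_fun (Cset : set (real_path R)) (fun y => sig (y (Agrid h sig y k)) ^+ 2).
Proof.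
have mA j : measurable_fun (Cset : set (real_path R)) (fun y => Agrid h sig y j) ->
    measurable_fun (Cset : set (real_path R)) (fun y => sig (y (Agrid h sig y j)) ^+ 2).
  move=> mAj; apply: measurable_funX; apply: (measurableT_comp msig).
  apply: (measurable_random_time (V := fun x : real_path R => x)) => //.
    exact: measurable_coord.
  by move=> x [].
suff mk : measurable_fun (Cset : set (real_path R)) (fun y => Agrid h sig y k).
  by split=> //; exact: mA.
elim: k => [|k IH] //=.
by apply: measurable_funD => //; apply: measurable_funM => //; exact: mA.
Qed.

Lemma measurable_Abar (t : R) :
  measurable_fun (Cset : set (real_path R)) (fun y => Abar h sig t y).
Proof.
rewrite /Abar; case: ltP => // t0 /=.
have [mA msA] := measurable_Agrid (cell h t).
by apply: measurable_funD => //; exact: measurable_funM.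
Qed.

Lemma measurable_time_change_inv (t : R) :
  measurable_fun (Cset : set (real_path R)) (fun y => time_change_inv y t).
Proof.
apply: (measurable_random_time (V := fun x : real_path R => x)) => //.
- exact: measurable_coord.
- by move=> x [].
- exact: measurable_Abar.
Qed.

Lemma time_change_Cstop_preimage (S S' : (R -> R) -> R) (A : set (R -> R)) :
  measurable_fun (Cset : set (real_path R)) S -> (forall x, Cset x -> 0 <= S x) ->
  (forall x, Cset x -> S' (time_change x) = rhobar h sig (S x) x) ->
  Cstop S' A -> Cstop S (Cset `&` time_change @^-1` A).
Proof.
move=> mS S0 SS'.
apply: (@time_change_Cstop _ _ (fun x t => rhobar h sig t x)) => //.
- exact: Cset_time_change.
- by move=> r _; exact: measurable_time_change.
- by move=> x s t s_ge0 st; rewrite (rhobar_lt h0 s00 sigb).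
- by move=> x s; exact: (rhobar_ge0 h0 s00 sigb).
- by move=> x x' s _ _; exact: time_change_local.
Qed.

(** The clock of the inverse map is [taubar] of the rebuilt path: [y] run until level [u] determines
    that path until this time. *)
Lemma time_change_inv_Cstop_preimage (S S' : (R -> R) -> R) (A : set (R -> R)) :
  measurable_fun (Cset : set (real_path R)) S' -> (forall y, Cset y -> 0 <= S' y) ->
  (forall y, Cset y ->
     S (time_change_inv y) = taubar h sig (S' y) (time_change_inv y)) ->
  Cstop S A -> Cstop S' (Cset `&` time_change_inv @^-1` A).
Proof.
move=> mS S0 SS'.
apply: (@time_change_Cstop _ _ (fun y u => taubar h sig u (time_change_inv y))) => //.
- exact: Cset_time_change_inv.
- by move=> r _; exact: measurable_time_change_inv.
- by move=> y s t s_ge0 st; rewrite (taubar_lt h0 s00 sigb).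
- by move=> y s; exact: (taubar_ge0 h0 s00 sigb).
- by move=> y y' s _ _; exact: time_change_inv_local.
Qed.

End TimeChange.

(** * Deterministic kernels *)

Section DeterministicKernel.
Context {R : realType} {T : Type} (D : set T).

(** The Dirac mass at [f x]. *)
Definition map_kernel (f : T -> T) (x : T) (A : set T) : R := \1_A (f x).

Lemma is_prob_on_map_kernel (F : set (set T)) (f : T -> T) (x : T) :
  D (f x) -> is_prob_on D F (map_kernel f x).
Proof.
move=> Dfx; rewrite /map_kernel; split; first by move=> A _; rewrite indicE.
split; first by rewrite indicE mem_set.
(* At most one set of a disjoint sequence contains [f x], so the partial sums are eventually
   constant. *)
move=> A _ trivA; have [[k _ Ak]|nA] := pselect ((\bigcup_k A k) (f x)); last first.
  rewrite indicE memNset//; apply: cvg_near_cst; apply: nearW => m.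
  rewrite big1// => i _; rewrite indicE memNset// => Ai; apply: nA.
  by exists i.
rewrite indicE mem_set; last by exists k.
apply: cvg_near_cst; exists k.+1 => // m /= km.
rewrite (bigD1 (Ordinal km))//= indicE mem_set// big1 ?addr0// => i ik.
rewrite indicE memNset// => Ai; move/eqP: ik; apply; apply/val_inj => /=.
by apply: trivA => //; exists (f x).
Qed.

(** The kernel takes only the values 0 and 1, so the preimage of [B] is one of four sets, according
    to which of these values [B] contains. *)
Lemma markov_map_kernel (F1 F2 : set (set T)) (f : T -> T) :
  (forall x, D x -> D (f x)) ->
  F1 D -> (forall A, F1 A -> F1 (D `\` A)) ->
  (forall A, F2 A -> F1 (D `&` f @^-1` A)) ->
  markov_kernel D F1 F2 (map_kernel f).
Proof.
move=> fD F1D F1C F1f; split=> [x Dx|A F2A B _].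
  exact/is_prob_on_map_kernel/fD.
have E : [set x | B (map_kernel f x A)] =
    [set x | (A (f x) /\ B 1) \/ (~ A (f x) /\ B 0)].
  apply/seteqP; split=> x /=; rewrite /map_kernel indicE;
    case: (pselect (A (f x))) => Ax; rewrite ?(mem_set Ax) ?(memNset Ax)/=.
  - by move=> B1; left.
  - by move=> B0; right.
  - by case=> -[].
  - by case=> -[].
have F1A := F1f A F2A; have F10 : F1 set0 by rewrite -(setDv D); exact: F1C.
rewrite E; have [B1|B1] := pselect (B 1); have [B0|B0] := pselect (B 0).
- rewrite (_ : _ `&` _ = D)//; apply/seteqP; split=> x /=; first by case.
  by move=> Dx; split=> //; case: (pselect (A (f x))) => Ax; [left|right].
- rewrite (_ : _ `&` _ = D `&` f @^-1` A)//; apply/seteqP; split=> x /= [Dx].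
    by case=> -[].
  by move=> Ax; split=> //; left.
- rewrite (_ : _ `&` _ = D `\` (D `&` f @^-1` A)); first exact: F1C.
  apply/seteqP; split=> x /= [Dx]; first by case=> -[? ?]//; split=> // -[].
  by move=> nA; split=> //; right; split=> // Ax; exact: nA.
- rewrite (_ : _ `&` _ = set0)//; apply/seteqP; split=> x //= [Dx].
  by case=> -[].
Qed.

(** The Dirac kernel has no error: the integral of the indicator of [A] at [f (Z1 b w)] is the
    probability that [Z2 b] lies in [A]. The lower bound comes from the value 0 put into the
    supremum. *)
Lemma deficiency_map d (Om : measurableType d) (P : probability Om R) {Par}
    (F1 F2 : set (set T)) (Th : set Par) (Z1 Z2 : Par -> Om -> T) (f : T -> T) :
  (forall x, D x -> D (f x)) ->
  F1 D -> (forall A, F1 A -> F1 (D `\` A)) ->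
  (forall A, F2 A -> F1 (D `&` f @^-1` A)) ->
  (forall b, Th b -> forall w, f (Z1 b w) = Z2 b w) ->
  (forall b, Th b -> forall A, F2 A -> measurable (Z2 b @^-1` A)) ->
  deficiency P D F1 F2 Th Z1 Z2 = 0%E.
Proof.
move=> fD F1D F1C F1f fZ mZ; apply/le_anti/andP; split; last first.
  apply: le_ereal_inf_tmp => _ [M _ <-]; apply: le_ereal_sup_tmp.
  by exists 0%E => //; left.
apply: ge_ereal_inf; eexists.
  by exists (map_kernel f) => //; exact: markov_map_kernel.
apply: ge_ereal_sup => _ [->//|[b Thb <-]].
apply: ge_ereal_sup => _ [A F2A <-].
rewrite (_ : (\int[P]_w _)%E = P (Z2 b @^-1` A)).
  by rewrite subee ?abse0// fin_num_measure//; exact: mZ.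
have -> : (fun w => (map_kernel f (Z1 b w) A)%:E) =
    (fun w => (\1_(Z2 b @^-1` A) w)%:E).
  by apply/funext => w; rewrite /map_kernel fZ// !indicE.
by rewrite integral_indic ?setIT//; exact: mZ.
Qed.

End DeterministicKernel.

(** * The Euler scheme *)

Section Euler.
Context {R : realType} (h : R) (b sig : R -> R).
Hypothesis h0 : 0 < h.

(** Unrolling the recursion [xigrid] puts the scheme in the form to which [continuous_grid_sum]
    applies. *)
Lemma Xi_grid_sum (e : R) (w : R -> R) (t : R) :
  Xi h b sig e w t = e + grid_sum h (fun k s =>
    let z := xigrid h b sig e w k in
    b z * (s - k%:R * h) + sig z * (w s - w (k%:R * h))) t.
Proof.
set G := fun k s => _.
have xE k : xigrid h b sig e w k = e + \sum_(i < k) G i (i.+1%:R * h).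
  elim: k => [|k IH]; first by rewrite big_ord0 addr0.
  rewrite big_ord_recr/= addrA -IH addrA; congr (_ + _ * _ + _).
  by rewrite -mulrBl -natrB// subSnn mul1r.
rewrite /Xi /grid_sum; case: ltP => _; last by rewrite addr0.
by rewrite addrA -xE addrA.
Qed.

Lemma Cset_Xi (e : R) (w : R -> R) :
  {within `[0, +oo[, continuous w} -> Cset (Xi h b sig e w).
Proof.
move=> wc; split; last by move=> t t0; rewrite /Xi ltxx ltNge ltW.
have -> : Xi h b sig e w = (fun t => e + grid_sum h (fun k s =>
    let z := xigrid h b sig e w k in
    b z * (s - k%:R * h) + sig z * (w s - w (k%:R * h))) t).
  by apply/funext => t; exact: Xi_grid_sum.
move=> t; apply: cvgD; first exact: cvg_cst.
move: t; apply: continuous_grid_sum => // k; first by rewrite /= !subrr !mulr0 addr0.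
move=> t /=; apply: cvgD; apply: cvgM; try exact: cvg_cst.
  by apply: cvgB; [exact: continuous_clamp|exact: cvg_cst].
apply: cvgB; last exact: cvg_cst.
(* The driving path is continuous only on the half-line, but clamped times are nonnegative, so the
   composition is continuous on all of [R]. *)
have c0 s : 0 <= clamp h k s by rewrite (le_trans (grid_ge0 h0 k))// clamp_ge.
have ct : `[0, +oo[%classic (clamp h k t) by rewrite /= in_itv/= c0.
move/subspace_continuousP : wc => /(_ _ ct) wt U /wt.
rewrite /within/= nbhs_simpl => Ut.
have /= := @continuous_clamp R h k t _ Ut; rewrite nbhs_simpl/=.
apply: filterS => s /=; apply.
by rewrite /= in_itv/= c0.
Qed.

Lemma measurable_Xi d (Om : measurableType d) (eta : Om -> R) (W : Om -> R -> R) :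
  measurable_fun setT b -> measurable_fun setT sig ->
  measurable_fun setT eta -> (forall t, measurable_fun setT (fun w => W w t)) ->
  forall t, measurable_fun setT (fun w => Xi h b sig (eta w) (W w) t).
Proof.
move=> mb msig meta mW t.
have step k c s : measurable_fun setT (fun w => xigrid h b sig (eta w) (W w) k) ->
    measurable_fun setT (fun w => let z := xigrid h b sig (eta w) (W w) k in
      z + b z * c + sig z * (W w s - W w (k%:R * h))).
  move=> mz; apply: measurable_funD; last first.
    by apply: measurable_funM; [exact: measurableT_comp|exact: measurable_funB].
  by apply: measurable_funD => //; apply: measurable_funM => //; exact: measurableT_comp.
have mgrid k : measurable_fun setT (fun w => xigrid h b sig (eta w) (W w) k).
  by elim: k => [|k IH] //=; exact: step.
by rewrite /Xi; case: ltP => // _; exact: step.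
Qed.

End Euler.

(** * Equivalence of the stopped experiments *)

Unset Implicit Arguments.
Set Strict Implicit.

Theorem theorem2 (R : realType) (sig : R -> R) (s0 s1 Ks K : R)
    (d : measure_display) (Om : measurableType d) (P : probability Om R)
    (W : Om -> R -> R) (eta : Om -> R) (h : R) (n : nat) (a : R) :
  condC sig s0 s1 Ks ->
  is_BM P W -> measurable_fun setT eta -> indep_init P eta W ->
  0 < h -> (1 <= n)%N -> 0 < a ->
  let X := fun (b : R -> R) (w : Om) => Xi h b sig (eta w) (W w) in
  let Z := fun (b : R -> R) (w : Om) => Zeta h b sig (eta w) (W w) in
  lecam P Cset (Cstop (fun _ => n%:R * h)) (Cstop (Abar h sig (n%:R * h)))
        (FK K) X Z = 0%E /\
  lecam P Cset (Cstop (taubar h sig a)) (Cstop (fun _ => a))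
        (FK K) X Z = 0%E.
Proof.
move=> [sigd [_ [_ [s00 [sigb _]]]]] [mW [_ [Wc _]]] meta _ h0 _ a0 X Z.
have sigc : continuous sig.
  by move=> x; apply/differentiable_continuous/derivable1_diffP; exact: sigd.
have XC b w : Cset (X b w) by exact: Cset_Xi.
have mX b r : FK K b -> measurable_fun setT (fun w => X b w r).
  move=> [bd _]; apply: measurable_Xi => //; apply: continuous_measurable_fun => //.
  by move=> x; apply/differentiable_continuous/derivable1_diffP; exact: bd.
have mXA b A : FK K b -> Cinf A -> measurable (X b @^-1` A).
  move=> FKb CA; rewrite -[X in measurable X]setTI.
  by apply: Cinf_preimage CA => // r _; exact: mX.
have ZE b w : Z b w = time_change h sig (X b w) by [].
have mZA b A : FK K b -> Cinf A -> measurable (Z b @^-1` A).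
  move=> FKb CA; rewrite (_ : _ @^-1` _ = X b @^-1` (Cset `&` time_change h sig @^-1` A)).
    apply: mXA => //; apply/CinfP; split=> [|x []//].
    apply: Cinf_preimage CA => //.
    - exact: measurable_Cset.
    - exact: (Cset_time_change h0 s00 sigb).
    - by move=> r _; exact: (measurable_time_change h0 s00 sigb).
  by apply/seteqP; split=> w //= [].
(* One map per direction serves as kernel, which leaves the stopping times and the preimages of
   stopped events to be checked. *)
have main (S S' : (R -> R) -> R) :
    Cstop S Cset -> Cstop S' Cset ->
    (forall A, Cstop S' A -> Cstop S (Cset `&` time_change h sig @^-1` A)) ->
    (forall A, Cstop S A -> Cstop S' (Cset `&` time_change_inv h sig @^-1` A)) ->
    lecam P Cset (Cstop S) (Cstop S') (FK K) X Z = 0%E.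
  move=> SC S'C SS' S'S; rewrite /lecam.
  rewrite (@deficiency_map _ _ _ _ _ _ _ _ _ _ _ _ (time_change h sig)) //.
  - rewrite (@deficiency_map _ _ _ _ _ _ _ _ _ _ _ _ (time_change_inv h sig)) ?maxxx//.
    + exact: Cset_time_change_inv.
    + by move=> A; exact: Cstop_setD.
    + by move=> b _ w; rewrite ZE; exact: (time_changeK h0 s00 sigb).
    + by move=> b FKb A [CA _]; exact: mXA.
  - exact: (Cset_time_change h0 s00 sigb).
  - by move=> A; exact: Cstop_setD.
  - by move=> b FKb A [CA _]; exact: mZA.
have preC (f : (R -> R) -> R -> R) : (forall x, Cset x -> Cset (f x)) ->
    Cset `&` f @^-1` Cset = Cset.
  by move=> fC; apply/seteqP; split=> x /=; [case|move=> Cx; split=> //; exact: fC].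
have T0 : 0 <= n%:R * h by exact: grid_ge0.
(* The stopping times of the first pair match: on a time-changed path, [Abar] at [n%:R * h] is the
   clock of the original path at that time. *)
have toT A : Cstop (Abar h sig (n%:R * h)) A ->
    Cstop (fun=> n%:R * h) (Cset `&` time_change h sig @^-1` A).
  apply: (time_change_Cstop_preimage h0 s00 sigb) => // x _.
  exact: (Abar_time_change h0 s00 sigb).
have toAT A : Cstop (fun=> n%:R * h) A ->
    Cstop (Abar h sig (n%:R * h)) (Cset `&` time_change_inv h sig @^-1` A).
  apply: (time_change_inv_Cstop_preimage h0 s00 sigb) => //.
  - exact: measurable_Abar.
  - by move=> y _; rewrite Abar_time_change_inv// (rhobar_ge0 h0 s00 sigb).
  - by move=> y _; rewrite Abar_time_change_inv// (taubar_rhobar h0 s00 sigb).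
(* In the second pair, [taubar] at [a] is the time at which the clock shows the constant [a]. *)
have totau A : Cstop (fun=> a) A ->
    Cstop (taubar h sig a) (Cset `&` time_change h sig @^-1` A).
  apply: (time_change_Cstop_preimage h0 s00 sigb) => //.
  - exact: (measurable_taubar h0 s00 sigb).
  - by move=> x _; exact: (taubar_ge0 h0 s00 sigb).
  - by move=> x _; have [] := taubar_spec h0 s00 sigb x (ltW a0).
have toa A : Cstop (taubar h sig a) A ->
    Cstop (fun=> a) (Cset `&` time_change_inv h sig @^-1` A).
  by apply: (time_change_inv_Cstop_preimage h0 s00 sigb) => // y _; exact: ltW.
(* It remains to see that [Abar] at [n%:R * h] and [taubar] at [a] are stopping times: [Cset] is the
   preimage of itself, and it belongs to the sigma-algebra at a constant time. *)
split; apply: main => //; try exact: Cstop_cst.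
  rewrite -[X in Cstop _ X](preC (time_change_inv h sig)); last first.
    exact: Cset_time_change_inv.
  exact/toAT/Cstop_cst.
rewrite -[X in Cstop _ X](preC (time_change h sig)); last first.
  exact: (Cset_time_change h0 s00 sigb).
exact/totau/Cstop_cst.
Qed.
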